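(* There is a constant $C$ such that for every string $w$, $\ell(w)\le C\, g(w)$; that is, $\ell = O(g)$.
   Context: L-system: a tuple $L=(V,R,S,\tau,d,n)$ where $V$ is a finite set of variables, $R: V\to V^+$ assigns to each variable a nonempty string (extended homomorphically to strings), $S\in V^*$ is the axiom, $\tau: V\to V$ is a coding (letter-to-letter map, extended homomorphically), $d\in\mathbb{N}$ and $n\in\mathbb{N}$. Its levels are $L_0=S$ and $L_{i+1}=R(L_i)$; it generates the string $w[1,n]=\tau(L_d[1,n])$. Its size is $|S|+\sum_{A\in V}|R(A)|$. $\ell(w)$ is the size of the smallest L-system generating $w$. A context-free grammar generating (only) $w$ is a sequence of nonterminals $X_1,\ldots,X_r$, each with exactly one rule $X_k\to A_{k,1}\cdots A_{k,\ell_k}$ where each $A_{k,t}$ is a terminal or one of $X_1,\ldots,X_{k-1}$; the expansion of a terminal is itself and $exp(X_k)=exp(A_{k,1})\cdots exp(A_{k,\ell_k})$; the grammar generates $exp(X_r)$, and its size is $\sum_k \ell_k$. $g(w)$ is the size of the smallest such grammar generating $w$. *)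

(* Defs.v *)
From mathcomp Require Import all_boot.
From mathcomp Require Import finmap.
From mathcomp Require Import boolp.

Set Implicit Arguments.
Unset Strict Implicit.
Unset Printing Implicit Defensive.

(* Homomorphic extension of a letter-to-string map. *)
Definition hom (A B : Type) (f : A -> seq B) (s : seq A) : seq B :=
  flatten (map f s).

(* Variables are drawn from T + nat: the letters inl a of the strings to be
   generated, and an unbounded supply inr i of other names.  A given V need not
   contain all of T, nor any letter that is not wanted. *)
Record lsystem (T : choiceType) := LSystem {
  lsV : {fset T + nat};
  lsR : lsV -> seq lsV;
  lsS : seq lsV;
  lstau : lsV -> lsV;
  lsd : nat;
  lsn : nat;
  lsR_nonempty : forall A : lsV, lsR A != [::]
}.

Definition level (T : choiceType) (L : lsystem T) (i : nat) : seq (lsV L) :=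
  iter i (hom (@lsR T L)) (lsS L).

Definition lsystem_generates (T : choiceType) (L : lsystem T) (w : seq T) :
    Prop :=
  lsn L <= size (level L (lsd L)) /\
  map val (map (@lstau T L) (take (lsn L) (level L (lsd L)))) = map inl w.

Definition lsystem_size (T : choiceType) (L : lsystem T) : nat :=
  size (lsS L) + \sum_(A : lsV L) size (lsR A).

(* Item k (from 0) of the sequence is the right-hand side of nonterminal number
   k; inl a is the terminal a and inr j is nonterminal number j.  The start
   symbol is the last nonterminal, and right-hand sides may be empty. *)
Record grammar (T : choiceType) := Grammar {
  rules : seq (seq (T + nat));
  rules_nonempty : rules != [::];
  rules_acyclic : forall k j : nat, inr j \in nth [::] rules k -> j < k
}.

(* Expansion of one symbol, E listing the expansions of the nonterminals
   already treated. *)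
Definition exp_symbol (T : Type) (E : seq (seq T)) (x : T + nat) : seq T :=
  match x with
  | inl a => [:: a]
  | inr j => nth [::] E j
  end.

Definition expansions (T : Type) (rs : seq (seq (T + nat))) : seq (seq T) :=
  foldl (fun E rhs => rcons E (hom (exp_symbol E) rhs)) [::] rs.

Definition grammar_generates (T : choiceType) (G : grammar T) (w : seq T) :
    Prop :=
  last [::] (expansions (rules G)) = w.

Definition grammar_size (T : choiceType) (G : grammar T) : nat :=
  \sum_(rhs <- rules G) size rhs.

Lemma exists_size (A : Type) (sz : A -> nat) (P : A -> Prop) :
  (exists a, P a) -> exists k, `[< exists2 a, P a & sz a = k >].
Proof. by move=> [a Pa]; exists (sz a); apply/asboolP; exists a. Qed.

Definition min_size (A : Type) (sz : A -> nat) (P : A -> Prop)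
    (exP : exists a, P a) : nat :=
  ex_minn (exists_size sz exP).

Lemma exists_lsystem (T : choiceType) (w : seq T) :
  exists L : lsystem T, lsystem_generates L w.
Proof.
pose u : seq (T + nat) := map inl w.
pose V : {fset T + nat} := seq_fset tt u.
pose S : seq V := pmap insub u.
exists (@LSystem T V (fun A => [:: A]) S id 0 (size S) (fun=> isT)).
split=> //=; rewrite take_size map_id.
rewrite (pmap_filter (insubK _)); apply/all_filterP/allP => x xu.
by rewrite isSome_insub /= seq_fsetE.
Qed.

Lemma exists_grammar (T : choiceType) (w : seq T) :
  exists G : grammar T, grammar_generates G w.
Proof.
have acyc k j : inr j \in nth [::] [:: map inl w : seq (T + nat)] k -> j < k.
  by case: k => [|k] /=; [case/mapP | rewrite nth_nil].
exists (@Grammar T [:: map inl w] isT acyc).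
rewrite /grammar_generates /= /hom -map_comp.
by elim: w {acyc} => //= a w ->.
Qed.

Definition smallest_lsystem_size (T : choiceType) (w : seq T) : nat :=
  min_size (@lsystem_size T) (exists_lsystem w).

Definition smallest_grammar_size (T : choiceType) (w : seq T) : nat :=
  min_size (@grammar_size T) (exists_grammar w).

(* Main.v *)
Require Import Defs.
From mathcomp Require Import all_boot.
From mathcomp Require Import finmap.
From mathcomp Require Import boolp.

(** A grammar is turned into an L-system by letting every terminal rewrite to
    itself, so that the expansion stabilises although the branches of the
    derivation tree have different depths; as many levels as there are rules
    suffice.  An L-system has no erasing rules, so the symbols with empty
    expansion are deleted first.  The axiom and the rules of the nonterminals
    then cost at most the grammar size each, and so do the rules [a -> a],
    since only the letters occurring in the grammar are kept. *)

Set Implicit Arguments.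
Unset Strict Implicit.
Unset Printing Implicit Defensive.

Section Hom.

Variables A B : Type.

Lemma hom_cat (f : A -> seq B) s t : hom f (s ++ t) = hom f s ++ hom f t.
Proof. by rewrite /hom map_cat flatten_cat. Qed.

Lemma hom_filter_nonempty (f : A -> seq B) s :
  hom f [seq x <- s | ~~ nilp (f x)] = hom f s.
Proof.
elim: s => //= x s IHs; rewrite /hom /= -/(hom f s) -IHs.
by case: ifPn => //= /negPn/nilP ->.
Qed.

End Hom.

Lemma iter_hom_cat (A : Type) (f : A -> seq A) d s t :
  iter d (hom f) (s ++ t) = iter d (hom f) s ++ iter d (hom f) t.
Proof. by elim: d => //= d ->; rewrite hom_cat. Qed.

Lemma eq_in_hom (A : eqType) (B : Type) (f g : A -> seq B) (s : seq A) :
  {in s, f =1 g} -> hom f s = hom g s.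
Proof. by move=> fg; rewrite /hom; congr flatten; apply/eq_in_map. Qed.

Lemma leq_sum_undup (I : eqType) (s : seq I) (F : I -> nat) :
  \sum_(x <- undup s) F x <= \sum_(x <- s) F x.
Proof.
elim: s => //= x s IHs; rewrite big_cons; case: ifP => _.
  exact: leq_trans IHs (leq_addl _ _).
by rewrite big_cons leq_add2l.
Qed.

Section Expansions.

Variable T : choiceType.
Implicit Types (rs : seq (seq (T + nat))) (E : seq (seq T)).

Lemma expansions_rcons rs r :
  expansions (rcons rs r) =
  rcons (expansions rs) (hom (exp_symbol (expansions rs)) r).
Proof. by rewrite /expansions foldl_rcons. Qed.

Lemma size_expansions rs : size (expansions rs) = size rs.
Proof.
by elim/last_ind: rs => // rs r IHrs; rewrite expansions_rcons !size_rcons IHrs.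
Qed.

(** The fold evaluates each right-hand side against the expansions of the earlier rules only. By
    acyclicity no later entry is consulted, so the defining equation also holds against the complete
    list; beyond its end both sides are empty. *)
Lemma nth_expansions rs k :
    (forall i j : nat, inr j \in nth [::] rs i -> j < i) ->
  nth [::] (expansions rs) k = hom (exp_symbol (expansions rs)) (nth [::] rs k).
Proof.
elim/last_ind: rs k => [|rs r IHrs] k acyc; first by rewrite !nth_nil.
have acyc' i j : inr j \in nth [::] rs i -> j < i.
  move=> jP; apply: acyc; rewrite nth_rcons; case: ltnP => // le_i.
  by rewrite nth_default in jP.
have stable i : i <= size rs ->
    hom (exp_symbol (expansions (rcons rs r))) (nth [::] (rcons rs r) i) =
    hom (exp_symbol (expansions rs)) (nth [::] (rcons rs r) i).
  move=> le_i; apply: eq_in_hom => -[a|j] //= /acyc lt_ji.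
  by rewrite expansions_rcons nth_rcons size_expansions (leq_trans lt_ji le_i).
have [lt_k|lt_k|->] := ltngtP k (size rs).
- rewrite stable ?(ltnW lt_k) // expansions_rcons !nth_rcons size_expansions.
  by rewrite lt_k IHrs.
- by rewrite !nth_default ?size_expansions ?size_rcons.
rewrite stable // expansions_rcons !nth_rcons size_expansions.
by rewrite ltnn eqxx.
Qed.

End Expansions.

Section GrammarToLSystem.

Variables (T : choiceType) (G : grammar T).

Let rs := rules G.
Let expand : T + nat -> seq T := exp_symbol (expansions rs).
Let productive (x : T + nat) : bool := ~~ nilp (expand x).
Let is_letter (x : T + nat) : bool := if x is inl _ then true else false.

Definition pruned_rule (x : T + nat) : seq (T + nat) :=
  match x with
  | inl a => [:: inl a]
  | inr k => [seq y <- nth [::] rs k | productive y]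
  end.

(** The start symbol itself is not a variable when the generated string is empty; its pruned
    right-hand side is a legal axiom in every case. *)
Let axiom : seq (T + nat) := pruned_rule (inr (size rs).-1).

(** Letters are kept with their repetitions, one per occurrence in a right-hand side, so that their
    number is at most the grammar size. *)
Let symbols : seq (T + nat) :=
  [seq x <- flatten rs | is_letter x] ++ map inr (iota 0 (size rs)).

Definition grammar_vars : {fset T + nat} :=
  seq_fset tt [seq x <- symbols | productive x].

Lemma expand_pruned_rule x : hom expand (pruned_rule x) = expand x.
Proof.
case: x => [a|k] //=; rewrite hom_filter_nonempty /expand /=.
by rewrite -nth_expansions //; apply: rules_acyclic.
Qed.

Lemma mem_grammar_vars x k :
  x \in nth [::] rs k -> productive x -> x \in grammar_vars.
Proof.
move=> xk px; rewrite seq_fsetE mem_filter px mem_cat.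
case: x xk px => [a|j] /= ak pj.
  rewrite mem_filter; apply/orP; left; apply/flattenP.
  exists (nth [::] rs k) => //.
  by apply: mem_nth; case: ltnP => // le_k; rewrite nth_default in ak.
apply/orP; right; rewrite mem_map; last by move=> ? ? [].
(* An index outside the list of rules gets the default expansion, which is empty, so a productive
   nonterminal has a rule. *)
rewrite mem_iota /= add0n ltnNge; apply: contra pj => le_j.
by rewrite /expand /= nth_default ?size_expansions.
Qed.

Lemma pruned_rule_vars x :
  x \in grammar_vars -> {subset pruned_rule x <= grammar_vars}.
Proof.
case: x => [a|k] xV y /=; first by rewrite inE => /eqP ->.
by rewrite mem_filter => /andP[py yk]; apply: mem_grammar_vars yk py.
Qed.

(** Pruning preserves expansions, so an empty pruned rule would make the expansion of a productive
    symbol empty. *)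
Lemma pruned_rule_nonempty x : x \in grammar_vars -> pruned_rule x != [::].
Proof.
rewrite seq_fsetE mem_filter => /andP[+ _].
by rewrite /productive -{1}expand_pruned_rule; apply: contra => /eqP ->.
Qed.

Definition to_vars (s : seq (T + nat)) : seq grammar_vars := pmap insub s.

Lemma to_varsK s : {subset s <= grammar_vars} -> map val (to_vars s) = s.
Proof.
move=> sV; rewrite (pmap_filter (insubK _)); apply/all_filterP/allP => x xs.
by rewrite isSome_insub sV.
Qed.

Definition grammar_rule (A : grammar_vars) : seq grammar_vars :=
  to_vars (pruned_rule (val A)).

Lemma val_grammar_rule A : map val (grammar_rule A) = pruned_rule (val A).
Proof. by rewrite to_varsK //; apply: pruned_rule_vars; apply: valP. Qed.

Lemma grammar_rule_nonempty A : grammar_rule A != [::].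
Proof.
have := pruned_rule_nonempty (valP A); rewrite -val_grammar_rule.
by case: grammar_rule.
Qed.

Definition lsystem_of_grammar : lsystem T :=
  @LSystem T grammar_vars grammar_rule (to_vars axiom) id (size rs)
    (size (last [::] (expansions rs))) grammar_rule_nonempty.

(** * The string generated by the L-system *)

Lemma axiom_vars : {subset axiom <= grammar_vars}.
Proof.
by move=> y; rewrite mem_filter => /andP[py yk]; apply: mem_grammar_vars yk py.
Qed.

Lemma val_level d :
  map val (level lsystem_of_grammar d) = iter d (hom pruned_rule) axiom.
Proof.
elim: d => [|d IHd]; first by rewrite to_varsK //; apply: axiom_vars.
rewrite /level /= -/(level lsystem_of_grammar d) -IHd /hom map_flatten.
by rewrite -!map_comp; congr flatten; apply: eq_map => A; apply: val_grammar_rule.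
Qed.

(** Letters are fixed and, by acyclicity, each rewriting replaces a nonterminal by symbols whose
    nonterminals have smaller indices. If all indices are below [d], then after [d] rewritings only
    letters remain. *)
Lemma iter_pruned_rule d s :
    (forall k, inr k \in s -> k < d) ->
  iter d (hom pruned_rule) s = map inl (hom expand s).
Proof.
elim: d s => [|d IHd] s.
  elim: s => [|[a|k] s IHs] //= sd.
    by congr cons; apply: IHs => k ks; apply: sd; rewrite inE ks orbT.
  by have := sd k; rewrite mem_head => /(_ isT).
elim: s => [|x s IHs] sd; first by rewrite iterSr IHd.
rewrite -cat1s iter_hom_cat hom_cat map_cat IHs; last first.
  by move=> k ks; apply: sd; rewrite inE ks orbT.
congr (_ ++ _); rewrite iterSr /hom /= !cats0 IHd ?expand_pruned_rule // => j.
case: x sd => [a|k] sd /=; first by rewrite inE.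
rewrite mem_filter => /andP[_ /rules_acyclic lt_jk].
by apply: leq_trans lt_jk _; rewrite -ltnS sd ?mem_head.
Qed.

Lemma lsystem_of_grammar_generates :
  lsystem_generates lsystem_of_grammar (last [::] (expansions rs)).
Proof.
have val_last : map val (level lsystem_of_grammar (size rs)) =
    map inl (last [::] (expansions rs)).
  rewrite val_level iter_pruned_rule => [|k].
    (* The axiom has the same expansion as the start symbol, the last nonterminal. *)
    by rewrite expand_pruned_rule /expand /= -nth_last size_expansions.
  rewrite mem_filter => /andP[_ /rules_acyclic lt_k].
  exact: leq_trans lt_k (leq_pred _).
have size_level : size (level lsystem_of_grammar (size rs)) =
    size (last [::] (expansions rs)).
  by rewrite -(size_map val) val_last size_map.
split; rewrite /= ?size_level //.
by rewrite map_id -size_level take_size val_last.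
Qed.

(** * Size bounds *)

Lemma size_axiom : size axiom <= grammar_size G.
Proof.
rewrite size_filter (leq_trans (count_size _ _)) // nth_last.
have: rs != [::] by apply: rules_nonempty.
rewrite /grammar_size -/rs; case/lastP: rs => // s r _.
by rewrite last_rcons -cats1 big_cat big_seq1 leq_addl.
Qed.

(** Each letter occurrence contributes 1, which gives at most one grammar size in total; the pruned
    right-hand sides give at most another. *)
Lemma sum_pruned_rule :
  \sum_(x <- symbols) size (pruned_rule x) <= 2 * grammar_size G.
Proof.
rewrite big_cat mul2n -addnn leq_add //.
  rewrite big_filter (eq_bigr (fun=> 1)) => [|[]//].
  rewrite sum1_count (leq_trans (count_size _ _)) //.
  by rewrite size_flatten sumnE big_map.
rewrite big_map /grammar_size -/rs (big_nth [::]) /index_iota subn0.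
by apply: leq_sum => k _; rewrite size_filter count_size.
Qed.

Lemma lsystem_of_grammar_size :
  lsystem_size lsystem_of_grammar <= 3 * grammar_size G.
Proof.
rewrite /lsystem_size /= (mulnDl 1 2) mul1n leq_add //.
  by rewrite -(size_map val) to_varsK ?size_axiom //; apply: axiom_vars.
under eq_bigr => A _ do rewrite -(size_map val) val_grammar_rule.
rewrite -(big_seq_fsetE _ _ predT (fun x => size (pruned_rule x))) /=.
rewrite /grammar_vars (perm_big _ (seq_fset_perm tt _)) /=.
(* The variables are the productive entries of [symbols] without repetition; restoring first the
   repetitions and then the unproductive entries only increases the sum. *)
apply: leq_trans (leq_sum_undup _ _) _.
rewrite big_filter (leq_trans _ sum_pruned_rule) //.
by rewrite [leqRHS](bigID productive) leq_addr.
Qed.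

End GrammarToLSystem.

Theorem theorem6 :
  exists C : nat, forall (T : choiceType) (w : seq T),
    smallest_lsystem_size w <= C * smallest_grammar_size w.
Proof.
(* One grammar size each for the axiom, the letter rules and the nonterminal rules. *)
exists 3 => T w; rewrite /smallest_grammar_size /min_size.
case: ex_minnP => _ /asboolP[G Gw <-] _.
rewrite /smallest_lsystem_size /min_size; case: ex_minnP => m _ min_m.
apply: leq_trans (lsystem_of_grammar_size G); apply: min_m.
apply/asboolP; exists (lsystem_of_grammar G) => //.
by rewrite -Gw; apply: lsystem_of_grammar_generates.
Qed.
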